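(* Let $(\delta_i^2,\widehat{w}_i)_{i=1}^n$ be the generalized eigenvalue-eigenvector pairs of the pencil $(H,\Gamma_{\rm pr}^{-1})$, i.e. $H\widehat{w}_i=\delta_i^2\,\Gamma_{\rm pr}^{-1}\widehat{w}_i$, with $\delta_i\ge0$, the ordering $\delta_i^2\ge\delta_{i+1}^2$ and the normalization $\widehat{w}_i^\top\Gamma_{\rm pr}^{-1}\widehat{w}_j=\delta_{ij}$ (Kronecker delta). Let $(\widehat{v}_i)$ be generalized eigenvectors of the pencil $(G\Gamma_{\rm pr}G^\top,\Gamma_{\rm obs})$ associated with a non-increasing sequence of eigenvalues, with the normalization $\widehat{v}_i^\top\Gamma_{\rm obs}\widehat{v}_i=1$. Let $1\le r\le n$. Then: (i) A solution of the problem of minimizing $\mathbb{E}\big(\|Ay-x\|^2_{\Gamma_{\rm pos}^{-1}}\big)$ over $A\in\mathcal{A}_r$ is given by $$A^\ast=\sum_{i=1}^r\frac{\delta_i}{1+\delta_i^2}\,\widehat{w}_i\widehat{v}_i^\top$$ (terms with $\delta_i=0$ being zero). (ii) The corresponding minimum Bayes risk over $\mathcal{A}_r$ is $$\mathbb{E}\big(\|A^\ast y-x\|^2_{\Gamma_{\rm pos}^{-1}}\big)=\mathbb{E}\big(\|A^\ast y-\mu_{\rm pos}(y)\|^2_{\Gamma_{\rm pos}^{-1}}\big)+\mathbb{E}\big(\|\mu_{\rm pos}(y)-x\|^2_{\Gamma_{\rm pos}^{-1}}\big)=\sum_{i>r}\delta_i^2+\ell ,$$ where $\ell=n$ is the dimension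 of the parameter space.
   Context: Bayesian linear model: $y\mid x\sim\mathcal{N}(Gx,\Gamma_{\rm obs})$, $x\sim\mathcal{N}(0,\Gamma_{\rm pr})$, where $G\in\mathbb{R}^{m\times n}$ and $\Gamma_{\rm obs}\in\mathbb{R}^{m\times m}$, $\Gamma_{\rm pr}\in\mathbb{R}^{n\times n}$ are symmetric positive definite; $x\in\mathbb{R}^n$ is the parameter. Set $H=G^\top\Gamma_{\rm obs}^{-1}G$. The posterior of $x$ given $y$ is $\mathcal{N}(\mu_{\rm pos}(y),\Gamma_{\rm pos})$ with $\Gamma_{\rm pos}=(H+\Gamma_{\rm pr}^{-1})^{-1}$ and $\mu_{\rm pos}(y)=\Gamma_{\rm pos}G^\top\Gamma_{\rm obs}^{-1}y$. Generalized eigenvectors of the pencil $(G\Gamma_{\rm pr}G^\top,\Gamma_{\rm obs})$ are nonzero vectors $v$ with $G\Gamma_{\rm pr}G^\top v=\lambda\,\Gamma_{\rm obs}v$ for some number $\lambda$ (the associated eigenvalue). $\mathcal{A}_r=\{A\in\mathbb{R}^{n\times m}:\ \mathrm{rank}(A)\le r\}$. For a symmetric positive definite $S$, $\|z\|_S^2=z^\top Sz$. Expectations are over the joint distribution of $(x,y)$. The Bayes risk of $Ay$ is $\mathbb{E}\big(\|Ay-x\|^2_{\Gamma_{\rm pos}^{-1}}\big)$.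
   Formalization: The v_i are taken linearly independent and matched to the w_i: when w_i and v_j share an eigenvalue, w_i^T G^T v_j is 0 for i≠j and ≥0 for i=j; with signs or eigenspace bases chosen independently (e.g. v_1 replaced by -v_1) the claim is false. *)

(* Defs.v *)
From HB Require Import structures.
From mathcomp Require Import all_boot all_order all_algebra.
From mathcomp Require Import all_classical all_reals all_analysis.

Set Implicit Arguments.
Unset Strict Implicit.
Unset Printing Implicit Defensive.

Import Order.TTheory GRing.Theory Num.Theory.
Import numFieldNormedType.Exports.

Local Open Scope classical_set_scope.
Local Open Scope ring_scope.

(* ||z||_S^2 = z^T S z *)
Definition wnorm2 (R : realType) (n : nat) (S : 'M[R]_n) (z : 'cV[R]_n) : R :=
  (z^T *m S *m z) 0 0.

Definition spd (R : realType) (n : nat) (S : 'M[R]_n) : Prop :=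
  S^T = S /\ forall z : 'cV[R]_n, z != 0 -> 0 < wnorm2 S z.

Definition gen_eigenpair (R : realType) (n : nat) (A B : 'M[R]_n)
    (a : R) (v : 'cV[R]_n) : Prop :=
  v != 0 /\ A *m v = a *: (B *m v).

(* The library's sigma-algebra on R^n (generated by the coordinates) lives on
   n.-tuple R; random vectors take values there and are read as columns. *)
Definition tcol (R : realType) (n : nat) (t : n.-tuple R) : 'cV[R]_n :=
  \col_i tnth t i.

(* mu = N(b, S) for positive definite S: every nonzero linear functional u^T z
   has the univariate law N(u^T b, u^T S u). The second argument of
   [normal_prob] is the standard deviation; u = 0 is left out because
   [normal_prob _ 0] is not the Dirac mass. *)
Definition gaussian_law (R : realType) (n : nat)
    (mu : set (n.-tuple R) -> \bar R) (b : 'cV[R]_n) (S : 'M[R]_n) : Prop :=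
  forall u : 'cV[R]_n, u != 0 -> forall B : set R, measurable B ->
    mu [set t | B ((u^T *m tcol t) 0 0)] =
    normal_prob ((u^T *m b) 0 0) (Num.sqrt (wnorm2 S u)) B.

(* x ~ N(0, Gpr) and y | x ~ N(G x, Gobs), the latter meaning that the Markov
   kernel t |-> N(G t, Gobs) is a regular conditional law of y given x. *)
Definition bayes_linear_model (R : realType) (m n : nat) (d : measure_display)
    (T : measurableType d) (P : probability T R)
    (x : {RV P >-> n.-tuple R}) (y : {RV P >-> m.-tuple R})
    (G : 'M[R]_(m, n)) (Gobs : 'M[R]_m) (Gpr : 'M[R]_n) : Prop :=
  gaussian_law (distribution P x) 0 Gpr /\
  exists K : R.-pker (n.-tuple R) ~> (m.-tuple R),
    (forall t, gaussian_law (K t) (G *m tcol t) Gobs) /\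
    forall (A : set (n.-tuple R)) (B : set (m.-tuple R)),
      measurable A -> measurable B ->
      P (x @^-1` A `&` y @^-1` B) =
      (\int[distribution P x]_(t in A) K t B)%E.

Definition hessian (R : realType) (m n : nat) (G : 'M[R]_(m, n))
    (Gobs : 'M[R]_m) : 'M[R]_n := G^T *m invmx Gobs *m G.

Definition post_cov (R : realType) (m n : nat) (G : 'M[R]_(m, n))
    (Gobs : 'M[R]_m) (Gpr : 'M[R]_n) : 'M[R]_n :=
  invmx (hessian G Gobs + invmx Gpr).

Definition post_mean (R : realType) (m n : nat) (G : 'M[R]_(m, n))
    (Gobs : 'M[R]_m) (Gpr : 'M[R]_n) (y : 'cV[R]_m) : 'cV[R]_n :=
  post_cov G Gobs Gpr *m G^T *m invmx Gobs *m y.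

(* (delta_i^2, w_i), i < n: ordered eigenpairs of the pencil (H, Gpr^-1). *)
Definition prior_eigenpairs (R : realType) (m n : nat) (G : 'M[R]_(m, n))
    (Gobs : 'M[R]_m) (Gpr : 'M[R]_n)
    (delta : 'I_n -> R) (w : 'I_n -> 'cV[R]_n) : Prop :=
  [/\ forall i, 0 <= delta i,
      forall i j : 'I_n, (i <= j)%N -> delta j ^+ 2 <= delta i ^+ 2,
      forall i, gen_eigenpair (hessian G Gobs) (invmx Gpr) (delta i ^+ 2) (w i)
    & forall i j, ((w i)^T *m invmx Gpr *m w j) 0 0 = (i == j)%:R].

(* v_0, ..., v_(m-1): unit eigenvectors of the pencil (G Gpr G^T, Gobs), with
   eigenvalues in non-increasing order and counted with multiplicity (whence
   the linear independence). Values of v and lam beyond m are irrelevant. *)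
Definition data_eigenvectors (R : realType) (m n : nat) (G : 'M[R]_(m, n))
    (Gobs : 'M[R]_m) (Gpr : 'M[R]_n)
    (lam : nat -> R) (v : nat -> 'cV[R]_m) : Prop :=
  [/\ forall i j : nat, (i <= j < m)%N -> lam j <= lam i,
      forall i : 'I_m, gen_eigenpair (G *m Gpr *m G^T) Gobs (lam i) (v i),
      forall i : 'I_m, wnorm2 Gobs (v i) = 1
    & row_free (\matrix_(i < m) (v i)^T)].

(* Eigenvectors are determined only up to sign, and up to the choice of a basis
   when an eigenvalue is repeated. The two families are matched when the
   singular-vector pairing w_i^T G^T v_j is, within each common eigenvalue,
   diagonal with nonnegative entries. Across distinct eigenvalues it vanishes
   automatically, so for simple eigenvalues only the signs are constrained. *)
Definition matched (R : realType) (m n : nat) (G : 'M[R]_(m, n))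
    (delta : 'I_n -> R) (w : 'I_n -> 'cV[R]_n)
    (lam : nat -> R) (v : nat -> 'cV[R]_m) : Prop :=
  forall (i : 'I_n) (j : 'I_m), delta i ^+ 2 = lam j ->
    ((i != j :> nat) -> ((w i)^T *m G^T *m v j) 0 0 = 0) /\
    ((i = j :> nat) -> 0 <= ((w i)^T *m G^T *m v j) 0 0).

(* There is no v_i for m <= i; delta_i = 0 then, so the term vanishes. *)
Definition Aopt (R : realType) (m n : nat) (r : nat)
    (delta : 'I_n -> R) (w : 'I_n -> 'cV[R]_n) (v : nat -> 'cV[R]_m) :
    'M[R]_(n, m) :=
  \sum_(i < n | (i < r)%N)
    (delta i / (1 + delta i ^+ 2)) *: (w i *m (v i)^T).

Definition bayes_risk (R : realType) (m n : nat) (d : measure_display)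
    (T : measurableType d) (P : probability T R)
    (x : {RV P >-> n.-tuple R}) (y : {RV P >-> m.-tuple R})
    (S : 'M[R]_n) (A : 'M[R]_(n, m)) : \bar R :=
  ('E_P[fun o => wnorm2 S (A *m tcol (y o) - tcol (x o))])%E.

(* Main.v *)
Require Import Defs.
From HB Require Import structures.
From mathcomp Require Import all_boot all_order all_algebra.
From mathcomp Require Import all_classical all_reals all_analysis.
From mathcomp Require Import measurable_realfun ring lra zify.

Set Implicit Arguments.
Unset Strict Implicit.
Unset Printing Implicit Defensive.

Import Order.TTheory GRing.Theory Num.Theory.
Import numFieldNormedType.Exports.

Local Open Scope classical_set_scope.
Local Open Scope ring_scope.

(** Both minimisation and value come from completing the square. Let
    S = H + Gpr^-1 be the posterior precision, N = G Gpr G^T + Gobs the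
    covariance of the data y, and K = Gpos G^T Gobs^-1 the gain, so that
    K y is the posterior mean. Since K N = Gpr G^T, the error covariance of a
    linear estimator A y splits as
      Cov (A y - x) = (A - K) N (A - K)^T + Gpos,
    and the risk of A is tr (S (A - K) N (A - K)^T) + tr (S Gpos), where the
    last trace is n ([error_cov_decomposition]). The first trace is the mean
    squared distance of A y to the posterior mean, which gives the splitting of
    the minimum risk.

    It remains to minimise that trace over rank A <= r. The generalized
    eigenvectors w_i, as columns of W with W^T Gpr^-1 W = 1, diagonalise
    everything: with L = diag (sqrt (1 + delta_i^2)) W^-1 one has S = L^T L,
    and the rows of C = L K are N-orthogonal with squared norms delta_i^2
    ([whitened_gain_cov]). The problem becomes the best approximation of C by a
    matrix of rank at most r in a Frobenius norm, where the Eckart-Young bound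
    gives the sum of the delta_i^2 with i >= r ([eckart_young]). The bound is
    attained by keeping the first r rows of C.

    That truncation is the matrix of the theorem because
    Gobs^-1 G w_i = delta_i v_i ([matched_singular_vectors]). The matrices
    Gpr H and Gobs^-1 G Gpr G^T are products of the same two factors in the two
    orders, so their characteristic polynomials agree up to a power of X. The
    sorted spectra therefore agree too, and the matching hypothesis selects
    v_i among the unit eigenvectors of its eigenvalue.

    On the probabilistic side only second moments of linear functionals of
    (x, y) are needed ([linear_model_second_moment]). They are computed by
    integrating first over y given x and then over x; both steps use
    E (Z + c)^2 = (mu + c)^2 + sigma^2 for a normal variable Z, which is proved
    from the Gaussian integral. *)

(** * Second moment of the Gaussian weight *)

Section GaussMoment.
Context {R : realType}.
Notation mu := (@lebesgue_measure R).
Import gauss_integral_proof.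

Lemma cvg_integral0_gauss : @integral0_gauss R x @[x --> +oo] --> Num.sqrt pi / 2.
Proof.
have : Num.sqrt (@integral0_gauss R x ^+ 2) @[x --> +oo]
    --> Num.sqrt (pi / 4).
  apply: continuous_cvg => //;
    [exact: sqrt_continuous|exact: cvg_integral0_gauss_sqr].
rewrite sqrtrM ?pi_ge0// sqrtrV// (_ : 4 = 2 ^+ 2); last first.
  by rewrite expr2 -natrM.
rewrite sqrtr_sqr ger0_norm//.
rewrite (_ : (fun _ => Num.sqrt _) = integral0_gauss)//.
apply/funext => r; rewrite sqrtr_sqr// ger0_norm//.
exact: integral0_gauss_ge0.
Qed.

Lemma is_derive_gauss_fun (x : R) :
  is_derive x (1 : R) (@gauss_fun R) (- (2 * x) * gauss_fun x).
Proof.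
rewrite /gauss_fun.
apply: is_derive_eq.
rewrite /GRing.scale/=; ring.
Qed.

Lemma is_derive_integral0_gauss (x : R) : 0 < x ->
  is_derive x (1 : R) (@integral0_gauss R) (gauss_fun x).
Proof.
move=> x0.
have [||||d1 d2] := @continuous_FTC1 R (@gauss_fun R) (BLeft 0) x (x + 1).
- by rewrite ltrDl.
- apply: (integrableS _ _ (@subsetT _ _)) => //=; exact: integrableT_gauss.
- by [].
- exact: continuous_gauss_fun.
by split; [exact: d1|rewrite -derive1E; exact: d2].
Qed.

Lemma cvg_id_gauss_fun : x * gauss_fun x @[x --> +oo] --> (0 : R).
Proof.
apply: (@squeeze_cvgr _ _ _ _ (cst 0) (fun x : R => x^-1)).
- near=> x.
  have x0 : 0 < x by near: x; exact: nbhs_pinfty_gt.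
  rewrite mulr_ge0 ?gauss_fun_ge0 ?(ltW x0)//=.
  rewrite /gauss_fun expRN -ler_pdivlMl// -invrM ?unitfE ?gt_eqF//.
  rewrite lef_pV2 ?posrE ?expR_gt0 ?mulr_gt0//.
  by have := expR_ge1Dx (x ^+ 2); rewrite expr2 => h; lra.
- exact: cvg_cst.
- apply/(@gtr0_cvgV0 R R (+oo) _ id); last exact: cvg_id.
  by near=> x; near: x; exact: nbhs_pinfty_gt.
Unshelve. all: by end_near. Qed.

(** The function (I(x) - x exp (- x^2)) / 2, with I(x) the integral of
    exp (- t^2) over [0, x], is a primitive of x^2 exp (- x^2): the derivative
    of I cancels the term exp (- x^2) of the product rule. It vanishes at 0 and
    tends to sqrt pi / 4. *)
Lemma integral0y_sqr_gauss :
  (\int[mu]_(x in `[0%R, +oo[) (x ^+ 2 * gauss_fun x)%:E = (Num.sqrt pi / 4)%:E)%E.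
Proof.
pose F (x : R) := (integral0_gauss x - x * gauss_fun x) / 2.
have dF (x : R) : 0 < x -> is_derive x (1 : R) F (x ^+ 2 * gauss_fun x).
  move=> x0; have := is_derive_gauss_fun x.
  have := is_derive_integral0_gauss x0 => h1 h2.
  rewrite /F; apply: is_derive_eq.
  by rewrite /GRing.scale/=; field.
have F0 : F 0 = 0.
  by rewrite /F /integral0_gauss set_itv1 Rintegral_set1 mul0r subr0 mul0r.
rewrite (@ge0_continuous_FTC2y R (fun x => x ^+ 2 * gauss_fun x) F 0 (Num.sqrt pi / 4))//.
- by rewrite F0 sube0.
- by move=> x _; rewrite mulr_ge0 ?sqr_ge0 ?gauss_fun_ge0.
- apply: continuous_subspaceT => x; apply: cvgM; last exact: continuous_gauss_fun.
  exact: exprn_continuous.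
- rewrite (_ : Num.sqrt pi / 4 = (Num.sqrt pi / 2 - 0) / 2); last by field.
  apply: cvgM; last exact: cvg_cst.
  by apply: cvgB; [exact: cvg_integral0_gauss|exact: cvg_id_gauss_fun].
- by move=> x /dF [].
- have C : {within `[0, 1], continuous F}.
    rewrite /F => x; apply: cvgM; last exact: cvg_cst.
    apply: cvgB.
      apply: parameterized_integral_continuous => //=.
      apply: (integrableS _ _ (@subsetT _ _)) => //=; exact: integrableT_gauss.
    have /continuous_subspaceT : continuous (fun z : R => z * gauss_fun z).
      by move=> z; apply: cvgM; [exact: cvg_id|exact: continuous_gauss_fun].
    exact.
  by move/continuous_within_itvP : C => /(_ ltr01) [].
- by move=> x; rewrite in_itv/= andbT => /dF [dd <-]; rewrite derive1E.
Qed.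

Lemma integralT_sqr_gauss :
  (\int[mu]_x (x ^+ 2 * gauss_fun x)%:E = (Num.sqrt pi / 2)%:E)%E.
Proof.
rewrite ge0_symfun_integralT//=.
- rewrite (_ : [set x | _] = `[0, +oo[%classic); last first.
    by apply/seteqP; split => x/=; rewrite in_itv/= andbT.
  by rewrite integral0y_sqr_gauss -EFinM; congr EFin; field.
- by move=> x; rewrite mulr_ge0 ?sqr_ge0 ?gauss_fun_ge0.
- move=> x; apply: cvgM; last exact: continuous_gauss_fun.
  exact: exprn_continuous.
- by move=> x/=; rewrite /gauss_fun sqrrN.
Qed.

End GaussMoment.

(** * Normal laws *)

Section NormalMoment.
Context {R : realType}.
Notation mu := (@lebesgue_measure R).
Local Open Scope ereal_scope.

Lemma ge0_integral_opp (f : R -> \bar R) :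
  measurable_fun [set: R] f -> (forall r, 0 <= f r) ->
  \int[mu]_r f (- r)%R = \int[mu]_r f r.
Proof.
move=> mf f0.
have := @ge0_integral_pushforward _ _ (measurableTypeR R) (measurableTypeR R) R
  (-%R : R -> R) _ mu setT f.
rewrite preimage_setT => <- //.
by apply: eq_measure_integral => A mA _; exact: lebesgue_measureN.
Qed.

(** Averaging with the reflection x |-> - x removes the cross term 2 a b x, so
    that only integrals of nonnegative functions occur and no integrability has
    to be checked. *)
Lemma integral_affine_sqr_gauss (a b : R) :
  \int[mu]_x ((a * x + b) ^+ 2 * gauss_fun x)%:E =
  ((a ^+ 2 / 2 + b ^+ 2) * Num.sqrt pi)%:E.
Proof.
have mg : measurable_fun [set: R] (@gauss_fun R) by exact: measurable_gauss_fun.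
have mf c d : measurable_fun [set: R] (fun x : R => (c * x + d) ^+ 2 * gauss_fun x)%R.
  apply: measurable_funM => //; apply: measurable_funX.
  by apply: measurable_funD => //; exact: measurable_funM.
have f0 (c d x : R) : 0 <= ((c * x + d) ^+ 2 * gauss_fun x)%:E.
  by rewrite lee_fin mulr_ge0 ?sqr_ge0 ?gauss_fun_ge0.
pose I b' := \int[mu]_x ((a * x + b') ^+ 2 * gauss_fun x)%:E.
have IN : I (- b)%R = I b.
  rewrite /I -ge0_integral_opp//; last exact/measurable_EFinP.
  apply: eq_integral => x _; congr EFin; rewrite /gauss_fun sqrrN; congr (_ * _)%R.
  by rewrite mulrN -opprD sqrrN.
have I2 : I b + I (- b)%R = (((a ^+ 2 / 2 + b ^+ 2) * Num.sqrt pi) * 2)%:E.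
  rewrite /I -ge0_integralD//; [|by apply/measurable_EFinP; exact: mf..].
  transitivity (\int[mu]_x ((2 * a ^+ 2)%:E * (x ^+ 2 * gauss_fun x)%:E
      + (2 * b ^+ 2)%:E * (gauss_fun x)%:E)).
    by apply: eq_integral => x _; rewrite -!EFinM -!EFinD; congr EFin; ring.
  have m2 : measurable_fun [set: R] (fun x : R => x ^+ 2 * gauss_fun x)%R.
    by apply: measurable_funM => //; exact: measurable_funX.
  have p2 (x : R) : 0 <= (x ^+ 2 * gauss_fun x)%:E.
    by rewrite lee_fin mulr_ge0 ?sqr_ge0 ?gauss_fun_ge0.
  have p1 (x : R) : 0 <= (gauss_fun x)%:E by rewrite lee_fin gauss_fun_ge0.
  have q (c : R) : (0 <= 2 * c ^+ 2)%R by rewrite mulr_ge0 ?sqr_ge0.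
  rewrite ge0_integralD//=.
  - rewrite !ge0_integralZl_EFin//; [|exact/measurable_EFinP..].
    rewrite integralT_sqr_gauss integralT_gauss -!EFinM -EFinD.
    by congr EFin; field.
  - move=> x _; by apply: mule_ge0; [rewrite lee_fin; exact: q|exact: p2].
  - by apply: emeasurable_funM => //; exact/measurable_EFinP.
  - move=> x _; by apply: mule_ge0; [rewrite lee_fin; exact: q|exact: p1].
  - by apply: emeasurable_funM => //; exact/measurable_EFinP.
rewrite -/(I b); move: I2; rewrite IN.
have : 0 <= I b by apply: integral_ge0.
case: (I b) => [r| |] //= _.
by rewrite -!EFinD => -[h]; congr EFin; lra.
Qed.

(** By uniqueness the Radon-Nikodym derivative of the normal law is almost
    everywhere its density, so the change of variables along the former gives
    integration against the latter. *)
Lemma ge0_integral_normal_prob (m s : R) (f : R -> \bar R) :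
  measurable_fun [set: R] f -> (forall x, 0 <= f x) ->
  \int[normal_prob m s]_x f x = \int[mu]_x (f x * (normal_pdf m s x)%:E).
Proof.
move=> mf f0.
have dom := normal_prob_dominates m s.
rewrite -(Radon_Nikodym_SigmaFinite.change_of_variables dom)//.
have mpdf : measurable_fun [set: R] (fun x => (normal_pdf m s x)%:E).
  by apply/measurable_EFinP; exact: measurable_normal_pdf.
have mf' := measurable_int _ (Radon_Nikodym_SigmaFinite.f_integrable dom).
have e : ae_eq mu setT (Radon_Nikodym_SigmaFinite.f (normal_prob m s) mu)
    (fun x => (normal_pdf m s x)%:E).
  apply: integral_ae_eq => //; first exact: Radon_Nikodym_SigmaFinite.f_integrable.
  by move=> E _ mE; rewrite -Radon_Nikodym_SigmaFinite.f_integral.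
apply: ae_eq_integral => //; [exact: emeasurable_funM..|].
by apply: filterS e => x h /h ->.
Qed.

(** The substitution x = m + s sqrt 2 w reduces this to
    [integral_affine_sqr_gauss]. *)
Lemma integral_sqr_normal_prob (m s c : R) : (0 < s)%R ->
  \int[normal_prob m s]_x ((x + c) ^+ 2)%:E = ((m + c) ^+ 2 + s ^+ 2)%:E.
Proof.
move=> s0; rewrite ge0_integral_normal_prob; last 2 first.
- by apply/measurable_EFinP; apply: measurable_funX; exact: measurable_funD.
- by move=> x; rewrite lee_fin sqr_ge0.
pose t := (s * Num.sqrt 2)%R.
have t0 : (0 < t)%R by rewrite mulr_gt0// sqrtr_gt0.
have t2 : (t ^+ 2 = s ^+ 2 *+ 2)%R by rewrite exprMn sqr_sqrtr// mulr_natr.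
have sp0 : (0 < Num.sqrt (@pi R))%R by rewrite sqrtr_gt0 pi_gt0.
(* The normalising factor 1 / sqrt pi of the density is absorbed into the
   square as (1 / sqrt (sqrt pi))^2. *)
pose G (w : R) := ((t / Num.sqrt (Num.sqrt pi) * w
  + (m + c) / Num.sqrt (Num.sqrt pi)) ^+ 2 * gauss_fun w)%R.
pose F (x : R) := ((x - m) / t)%R.
have dF (x : R) : is_derive x (1 : R)%R F (t^-1)%R.
  by rewrite /F; apply: is_derive_eq; rewrite /GRing.scale/=; ring.
have F'E : (F^`())%classic = cst t^-1%R.
  by apply/funext => x; have [_ <-] := dF x; rewrite derive1E.
transitivity (\int[mu]_x (((G \o F) * F^`()%classic) x)%:E).
  apply: eq_integral => x _; rewrite -EFinM; congr EFin.
  rewrite F'E !fctE/= normal_pdfE ?gt_eqF// /G /F.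
  have -> : gauss_fun ((x - m) / t) = normal_fun m s x.
    by rewrite /normal_fun/gauss_fun -t2 exprMn exprVn mulNr.
  rewrite /normal_peak.
  have -> : (Num.sqrt (s ^+ 2 * pi *+ 2) = t * Num.sqrt pi)%R.
    rewrite -mulrnAl -t2 sqrtrM ?sqr_ge0// sqrtr_sqr gtr0_norm//.
  set q := Num.sqrt (Num.sqrt pi).
  have <- : (q ^+ 2 = Num.sqrt pi)%R by rewrite sqr_sqrtr// ltW.
  have q0 : q != 0%R by rewrite gt_eqF// sqrtr_gt0.
  field; by rewrite q0 gt_eqF.
rewrite -increasing_ge0_integration_by_substitutionT//.
- rewrite integral_affine_sqr_gauss; congr EFin.
  rewrite !expr_div_n t2 sqr_sqrtr ?ltW//; field.
  by rewrite gt_eqF.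
- by move=> x y xy; rewrite /F ltr_pM2r ?invr_gt0// ltrD2r.
- by rewrite F'E => ?; exact: cvg_cst.
- by rewrite F'E; exact: is_cvg_cst.
- by rewrite F'E; exact: is_cvg_cst.
- apply/gt0_cvgMlNy; last exact: cvg_addrr_Ny.
  by rewrite invr_gt0.
- apply/gt0_cvgMly; last exact: cvg_addrr.
  by rewrite invr_gt0.
- move=> w; apply: cvgM; last exact: continuous_gauss_fun.
  apply: (cvg_comp (fun w : R => t / Num.sqrt (Num.sqrt pi) * w
    + (m + c) / Num.sqrt (Num.sqrt pi)) (fun z : R => z ^+ 2))%R.
    apply: cvgD; last exact: cvg_cst.
    by apply: cvgM; [exact: cvg_cst|exact: cvg_id].
  exact: exprn_continuous.
- by move=> w; rewrite mulr_ge0 ?sqr_ge0 ?gauss_fun_ge0.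
Qed.

End NormalMoment.

(** * Integration against a regular conditional law *)

Section Disintegration.
Context d1 d2 (T1 : measurableType d1) (T2 : measurableType d2) (R : realType).
Local Open Scope ereal_scope.

Section ConstKernel.
Variable mu : probability T1 R.

(** A measure seen as a kernel, so that [kcomp] below is a genuine measure on the
    product space. *)
Definition kconst (_ : T1) : {measure set T1 -> \bar R} := mu.

Let measurable_kconst U : measurable U -> measurable_fun [set: T1] (kconst ^~ U).
Proof. by move=> _; exact: measurable_cst. Qed.

HB.instance Definition _ := isKernel.Build _ _ _ _ R kconst measurable_kconst.

Let kconst_setT t : kconst t [set: T1] = 1.
Proof. exact: probability_setT. Qed.

HB.instance Definition _ :=
  Kernel_isProbability.Build _ _ _ _ R kconst kconst_setT.
End ConstKernel.

Section PairKernel.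
Variable K : R.-pker T1 ~> T2.

(** The law of (t, Y) when Y has law K t; composing with the law of x rebuilds
    the joint law of the pair. The first component of the source is the dummy
    parameter that [kcomp] requires. *)
Definition kpair (z : T1 * T1) : {measure set (T1 * T2) -> \bar R} :=
  measure_function_pushforward__canonical__measure_function_Measure
    (K z.2) (measurable_pair1 z.2).

Lemma kpairE (z : T1 * T1) U : kpair z U = K z.2 (xsection U z.2).
Proof. by rewrite /kpair/= /pushforward xsectionE. Qed.

Let measurable_kpair U : measurable U -> measurable_fun [set: T1 * T1] (kpair ^~ U).
Proof.
move=> mU.
rewrite [X in measurable_fun _ X](_ : _ = (fun t => K t (xsection U t)) \o snd).
  apply: measurableT_comp => //.
  by apply: measurable_fun_xsection_finite_kernel; rewrite inE.
by apply/funext => z /=; rewrite -kpairE.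
Qed.

HB.instance Definition _ := isKernel.Build _ _ _ _ R kpair measurable_kpair.

Let kpair_setT z : kpair z [set: T1 * T2] = 1.
Proof. by rewrite kpairE xsectionE preimage_setT prob_kernel. Qed.

HB.instance Definition _ := Kernel_isProbability.Build _ _ _ _ R kpair kpair_setT.
End PairKernel.

(** The law of (x, y) and the composition of the law of x with the pairing kernel
    are two finite measures that agree on rectangles, hence are equal; Tonelli
    for kernels ([integral_kcomp]) then gives the iterated integral. *)
Lemma ge0_integral_disintegration d (T : measurableType d) (P : probability T R)
    (x : {RV P >-> T1}) (y : {RV P >-> T2}) (K : R.-pker T1 ~> T2)
    (f : T1 * T2 -> \bar R) :
  (forall A B, measurable A -> measurable B ->
    P (x @^-1` A `&` y @^-1` B) = \int[distribution P x]_(t in A) K t B) ->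
  measurable_fun [set: T1 * T2] f -> (forall z, 0 <= f z) ->
  \int[P]_o f (x o, y o) =
  \int[distribution P x]_t \int[K t]_s f (t, s).
Proof.
move=> hK mf f0.
pose xy o := (x o, y o).
have mxy : measurable_fun [set: T] xy by exact: measurable_fun_pair.
have -> : \int[P]_o f (x o, y o) = \int[pushforward P xy]_z f z.
  by rewrite ge0_integral_pushforward.
pose mu := distribution P x.
have [t0 _] : exists t : T1, True.
  by exists point.
transitivity (\int[mkcomp (kconst mu) (kpair K) t0]_z f z); last first.
  rewrite integral_kcomp//; apply: eq_integral => t _.
  by rewrite /kpair ge0_integral_pushforward.
apply: eq_measure_integral => C mC _.
pose G : set (set (T1 * T2)) :=
  [set C | exists2 A, measurable A & exists2 B, measurable B & C = A `*` B].
apply: (@measure_unique _ _ _ G (fun=> setT)) => //.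
- rewrite measurable_prod_measurableType; congr (<<s _ >>).
  rewrite predeqE; split => [[A mA [B mB <-]]|[A mA [B mB ->]]].
    by exists A => //; exists B.
  by exists A => //; exists B.
- move=> _ _ [A1 mA1 [B1 mB1 ->]] [A2 mA2 [B2 mB2 ->]].
  rewrite -setXI; exists (A1 `&` A2); first exact: measurableI.
  by exists (B1 `&` B2) => //; exact: measurableI.
- by move=> _; exists setT => //; exists setT => //; rewrite setXTT.
- by rewrite bigcup_const.
- move=> _ [A mA [B mB ->]].
  rewrite /= /pushforward (_ : xy @^-1` (A `*` B) = x @^-1` A `&` y @^-1` B)//.
  rewrite hK// [LHS]integral_mkcond [RHS]/kcomp.
  rewrite /kconst.
  apply: eq_integral => t _.
  rewrite patchE kpairE; case: ifPn => tA.
    by rewrite in_xsectionX.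
  by rewrite notin_xsectionX// measure0.
- by move=> _; rewrite /= /pushforward preimage_setT probability_setT ltry.
Qed.

End Disintegration.

(** * Second moments in the linear model *)

Section LinearFunctionals.
Context {R : realType}.

Lemma measurable_dot_tcol n (u : 'cV[R]_n) :
  measurable_fun [set: n.-tuple R] (fun t => (u^T *m tcol t) 0 0).
Proof.
rewrite [X in measurable_fun _ X](_ : _ = (fun t : n.-tuple R => \sum_i u i 0 * tnth t i)).
  apply: measurable_sum => i; apply: measurable_funM => //.
  exact: measurable_tnth.
by apply/funext => t; rewrite mxE; apply: eq_bigr => i _; rewrite !mxE.
Qed.

Lemma gaussian_law_second_moment n (mu : {measure set (n.-tuple R) -> \bar R})
    (b : 'cV[R]_n) (S : 'M[R]_n) (u : 'cV[R]_n) (c : R) :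
  mu setT = 1%E -> spd S -> gaussian_law mu b S ->
  (\int[mu]_t (((u^T *m tcol t) 0 0 + c) ^+ 2)%:E =
   (((u^T *m b) 0 0 + c) ^+ 2 + wnorm2 S u)%:E)%E.
Proof.
move=> mu1 [_ S0] hmu.
have [->|u0] := eqVneq u 0.
  rewrite /wnorm2 trmx0 !mul0mx !mxE add0r addr0.
  under eq_integral do rewrite mul0mx mxE add0r.
  by rewrite integral_cst// mu1 mule1.
have := S0 _ u0 => q0.
(* The target carries the measurable structure on which the normal law lives. *)
pose phi (t : n.-tuple R) : measurableTypeR R := (u^T *m tcol t) 0 0.
have mphi : measurable_fun setT phi by exact: measurable_dot_tcol.
transitivity (\int[pushforward mu phi]_z ((z + c) ^+ 2)%:E)%E.
  rewrite [RHS]ge0_integral_pushforward//.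
  - by apply/measurable_EFinP; apply: measurable_funX; exact: measurable_funD.
  - by move=> z _; rewrite lee_fin sqr_ge0.
have s0 : 0 < Num.sqrt (wnorm2 S u) by rewrite sqrtr_gt0.
rewrite -[in RHS](sqr_sqrtr (ltW q0)) -integral_sqr_normal_prob//.
by apply: eq_measure_integral => A mA _; exact: hmu.
Qed.

(** Given x = t, the functional is normal with mean (a + G^T b)^T t and variance
    b^T Gobs b; averaging over t adds the second moment of the mean. *)
Lemma linear_model_second_moment m n d (T : measurableType d) (P : probability T R)
    (x : {RV P >-> n.-tuple R}) (y : {RV P >-> m.-tuple R})
    (G : 'M[R]_(m, n)) (Gobs : 'M[R]_m) (Gpr : 'M[R]_n)
    (a : 'cV[R]_n) (b : 'cV[R]_m) :
  spd Gobs -> spd Gpr -> bayes_linear_model x y G Gobs Gpr ->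
  (\int[P]_o (((a^T *m tcol (x o)) 0 0 + (b^T *m tcol (y o)) 0 0) ^+ 2)%:E =
   (wnorm2 Gpr (a + G^T *m b) + wnorm2 Gobs b)%:E)%E.
Proof.
move=> so sp [hx [K [hK joint]]].
pose f (z : n.-tuple R * m.-tuple R) :=
  (((a^T *m tcol z.1) 0 0 + (b^T *m tcol z.2) 0 0) ^+ 2)%:E.
have mf : measurable_fun setT f.
  apply/measurable_EFinP; apply: measurable_funX; apply: measurable_funD.
    exact: (measurableT_comp (measurable_dot_tcol a) measurable_fst).
  exact: (measurableT_comp (measurable_dot_tcol b) measurable_snd).
rewrite (ge0_integral_disintegration joint (f := f))//; last first.
  by move=> z; rewrite lee_fin sqr_ge0.
transitivity (\int[distribution P x]_t
    ((((a + G^T *m b)^T *m tcol t) 0 0 + 0) ^+ 2 + wnorm2 Gobs b)%:E)%E.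
  apply: eq_integral => t _; rewrite /f/=.
  under eq_integral do rewrite addrC.
  rewrite (gaussian_law_second_moment _ _ _ so (hK t)); last exact: prob_kernel.
  congr (EFin (_ ^+ 2 + _)).
  by rewrite addr0 linearD/= mulmxDl trmx_mul trmxK -mulmxA [RHS]mxE addrC.
have q0 : 0 <= wnorm2 Gobs b.
  have [->|/so.2 /ltW//] := eqVneq b 0.
  by rewrite /wnorm2 trmx0 !mul0mx mxE.
under eq_integral do rewrite EFinD.
rewrite ge0_integralD//; last 2 first.
- by move=> t _; rewrite lee_fin sqr_ge0.
- apply/measurable_EFinP; apply: measurable_funX; apply: measurable_funD => //.
  exact: measurable_dot_tcol.
rewrite (gaussian_law_second_moment _ _ _ sp hx); last exact: probability_setT.
rewrite integral_cst// [X in (_ * X)%E]probability_setT mule1 -EFinD.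
by rewrite mulmx0 mxE addr0 expr0n add0r.
Qed.

End LinearFunctionals.

(** * Symmetric positive definite matrices *)

Section SpdTheory.
Context {R : realType}.

Lemma wnorm2D n (S S' : 'M[R]_n) z : wnorm2 (S + S') z = wnorm2 S z + wnorm2 S' z.
Proof. by rewrite /wnorm2 mulmxDr mulmxDl mxE. Qed.

Lemma wnorm2_conj m n (B : 'M[R]_(m, n)) (S : 'M[R]_n) z :
  wnorm2 (B *m S *m B^T) z = wnorm2 S (B^T *m z).
Proof. by rewrite /wnorm2 trmx_mul trmxK !mulmxA. Qed.

Lemma wnorm2_gram m n (L : 'M[R]_(m, n)) z :
  wnorm2 (L^T *m L) z = \sum_i (L *m z) i 0 ^+ 2.
Proof.
rewrite /wnorm2 mulmxA -trmx_mul -mulmxA mxE.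
by apply: eq_bigr => i _; rewrite mxE expr2.
Qed.

Lemma spd_psd n (S : 'M[R]_n) : spd S -> forall z, 0 <= wnorm2 S z.
Proof.
move=> [_ S0] z; have [->|/S0/ltW//] := eqVneq z 0.
by rewrite /wnorm2 trmx0 !mul0mx mxE.
Qed.

Lemma spd_unitmx n (S : 'M[R]_n) : spd S -> S \in unitmx.
Proof.
move=> [ST S0]; rewrite -row_free_unit -kermx_eq0.
apply/negPn/negP => /rowV0Pn [v /sub_kermxP vS v0].
have := S0 v^T; rewrite /wnorm2 trmxK vS mul0mx mxE ltxx => h.
suff : false by []; apply: h.
by apply: contra v0 => /eqP e; rewrite -[v]trmxK e trmx0.
Qed.

Lemma spd_invmx n (S : 'M[R]_n) : spd S -> spd (invmx S).
Proof.
move=> spdS; have uS := spd_unitmx spdS; case: spdS => ST S0.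
split; first by rewrite trmx_inv ST.
move=> z z0; rewrite (_ : invmx S = invmx S *m S *m (invmx S)^T); last first.
  by rewrite mulVmx// mul1mx trmx_inv ST.
rewrite wnorm2_conj; apply: S0; apply: contra z0 => /eqP; rewrite trmx_inv ST => e.
by rewrite -(mulKVmx uS z) e mulmx0.
Qed.

End SpdTheory.

(** * The Eckart-Young lower bound *)

Section EckartYoung.
Context {R : realType}.

Lemma mxtrace_wnorm2 n m (N : 'M[R]_m) (Y : 'M[R]_(n, m)) :
  \tr (Y *m N *m Y^T) = \sum_i wnorm2 N (row i Y)^T.
Proof.
apply: eq_bigr => i _; rewrite /wnorm2 trmxK -row_mul mxE [RHS]mxE.
by apply: eq_bigr => j _; rewrite !mxE.
Qed.

Lemma mxtrace_psd n m (N : 'M[R]_m) (Y : 'M[R]_(n, m)) :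
  (forall z, 0 <= wnorm2 N z) -> 0 <= \tr (Y *m N *m Y^T).
Proof. by move=> N0; rewrite mxtrace_wnorm2; exact: sumr_ge0. Qed.

Lemma mul_mx_tr_diag_ge0 n m (Y : 'M[R]_(n, m)) i : 0 <= (Y *m Y^T) i i.
Proof. by rewrite mxE; apply: sumr_ge0 => j _; rewrite mxE -expr2 sqr_ge0. Qed.

Lemma row_sqr_gt0 n (v : 'rV[R]_n) : v != 0 -> 0 < (v *m v^T) 0 0.
Proof.
move=> v0; rewrite lt_neqAle mul_mx_tr_diag_ge0 andbT eq_sym.
apply: contra v0 => /eqP; rewrite mxE => /eqP.
rewrite psumr_eq0 => [/allP h|j _]; last by rewrite mxE -expr2 sqr_ge0.
apply/eqP/rowP => j; have := h j (mem_index_enum _).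
by rewrite !mxE -expr2 sqrf_eq0 => /eqP.
Qed.

(** Gram-Schmidt, one row at a time: while fewer than rank K rows are chosen, K
    meets the orthogonal complement of their span by dimension count. *)
Lemma orthonormal_rows k n (K : 'M[R]_n) : (k <= \rank K)%N ->
  exists2 Z : 'M[R]_(k, n), Z *m Z^T = 1%:M & (Z <= K)%MS.
Proof.
elim: k => [|k IH] kK.
  by exists 0; [apply/matrixP => -[]|exact: sub0mx].
have [Z ZZ ZK] := IH (ltnW kK).
have : (K :&: kermx Z^T)%MS != 0.
  rewrite -mxrank_eq0 -lt0n.
  have := mxrank_sum_cap K (kermx Z^T).
  have := rank_leq_col (K + kermx Z^T)%MS.
  have := rank_leq_row Z; have := rank_leq_col Z.
  rewrite mxrank_ker mxrank_tr; lia.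
move=> /rowV0Pn [v]; rewrite sub_capmx => /andP[vK /sub_kermxP vZ] v0.
pose c := (v *m v^T) 0 0.
have c0 : 0 < c := row_sqr_gt0 v0.
pose u := (Num.sqrt c)^-1 *: v.
exists (col_mx u Z : 'M[R]_(1 + k, n)).
  have uZ : u *m Z^T = 0 by rewrite -scalemxAl vZ scaler0.
  have uu : u *m u^T = 1%:M.
    rewrite [LHS]mx11_scalar; congr (_%:M).
    rewrite linearZ/= -scalemxAl -scalemxAr 2!mxE -/c mulrA -invfM -expr2.
    by rewrite sqr_sqrtr ?ltW// mulVf ?gt_eqF.
  have Zu : Z *m u^T = 0 by rewrite -[LHS]trmxK trmx_mul trmxK uZ trmx0.
  suff : @col_mx R 1 k n u Z *m (@col_mx R 1 k n u Z)^T = 1%:M by [].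
  by rewrite tr_col_mx mul_col_row uu uZ ZZ Zu -scalar_mx_block.
rewrite (_ : (_ <= K)%MS = (@col_mx R 1 k n u Z <= K)%MS)//.
by rewrite -addsmxE addsmx_sub ZK andbT scalemx_sub.
Qed.

(** With n - r units of weight and at most one unit per index, the smallest
    weighted sum puts them on the n - r smallest values. The comparison goes
    through the threshold value s = sig r: every term of
    sum_i (tau i - [r <= i]) (sig i - s) is nonnegative. *)
Lemma weighted_sum_ge n r (sig tau : 'I_n -> R) :
  (forall i j : 'I_n, (i <= j)%N -> sig j <= sig i) ->
  (forall i, 0 <= tau i <= 1) -> \sum_i tau i = (n - r)%:R ->
  \sum_(i < n | (r <= i)%N) sig i <= \sum_i tau i * sig i.
Proof.
move=> hs ht st.
have [nr|rn] := leqP n r.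
  rewrite big_pred0 => [|i]; last by rewrite leqNgt (leq_trans (ltn_ord i) nr).
  have t0 : forall i, i \in 'I_n -> tau i = 0.
    move: st; rewrite (eqP (_ : n - r == 0)%N)// => /eqP.
    rewrite psumr_eq0 => [/allP h i _|i _]; last by case/andP: (ht i).
    by apply/eqP; apply: h; rewrite mem_index_enum.
  by rewrite big1// => i _; rewrite t0// mul0r.
pose s := sig (Ordinal rn).
pose e (i : 'I_n) : R := (r <= i)%N%:R.
have sumE (f : 'I_n -> R) : \sum_(i < n | (r <= i)%N) f i = \sum_i e i * f i.
  by rewrite big_mkcond; apply: eq_bigr => i _; rewrite /e; case: leqP; rewrite (mul1r, mul0r).
have se : \sum_i e i = (n - r)%:R.
  rewrite -(sumr_const_nat n r) big_geq_mkord sumE.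
  by apply: eq_bigr => i _; rewrite mulr1.
rewrite sumE -subr_ge0 -sumrB.
have -> : \sum_i (tau i * sig i - e i * sig i) = \sum_i (tau i - e i) * (sig i - s).
  apply/eqP; rewrite -subr_eq0 -sumrB; apply/eqP.
  transitivity ((\sum_i tau i - \sum_i e i) * s); last by rewrite st se subrr mul0r.
  by rewrite -sumrB mulr_suml; apply: eq_bigr => i _; ring.
apply: sumr_ge0 => i _; have /andP[t0 t1] := ht i.
rewrite /e; have [ri|ir] := leqP r i.
  by rewrite mulr_le0// subr_le0// hs.
by rewrite subr0 mulr_ge0// subr_ge0 hs// ltnW.
Qed.

(** Let Z have n - r orthonormal rows, all annihilated by X. Projecting the rows
    of X - C by Z can only decrease the norm, and leaves - Z C. Because the rows
    of C are orthogonal, the norm of Z C is a weighted sum of the sig i with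
    weights (Z^T Z)_ii, which lie in [0, 1] and add up to n - r. *)
Lemma eckart_young n m r (N : 'M[R]_m) (C X : 'M[R]_(n, m)) (sig : 'I_n -> R) :
  (forall z, 0 <= wnorm2 N z) ->
  C *m N *m C^T = diag_mx (\row_i sig i) ->
  (forall i j : 'I_n, (i <= j)%N -> sig j <= sig i) ->
  (\rank X <= r)%N ->
  \sum_(i < n | (r <= i)%N) sig i <= \tr ((X - C) *m N *m (X - C)^T).
Proof.
move=> N0 CC hs rX.
have [|Z ZZ ZX] := @orthonormal_rows (n - r) n (kermx X).
  by rewrite mxrank_ker leq_sub2l.
have {}ZX : Z *m X = 0 by apply/sub_kermxP.
(* Q is the orthogonal projection complementary to Z^T Z. *)
pose Q := 1%:M - Z^T *m Z.
have QT : Q^T = Q by rewrite /Q linearB/= trmx1 trmx_mul trmxK.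
have QQ : Q *m Q = Q.
  rewrite /Q mulmxBl mul1mx mulmxBr mulmx1 mulmxA -(mulmxA _ Z) ZZ mulmx1 subrr.
  by rewrite subr0.
pose Y := X - C; pose V := Y *m N *m Y^T.
have trE k (A : 'M[R]_(k, n)) :
    \tr (A *m Y *m N *m (A *m Y)^T) = \tr (A^T *m A *m V).
  by rewrite trmx_mul -!mulmxA [RHS]mxtrace_mulC /V -!mulmxA.
have ZC : Z *m Y = - (Z *m C) by rewrite mulmxBr ZX sub0r.
have -> : \tr V = \tr (Z *m (C *m N *m C^T) *m Z^T) +
    \tr (Q *m Y *m N *m (Q *m Y)^T).
  have -> : Z *m (C *m N *m C^T) *m Z^T = Z *m Y *m N *m (Z *m Y)^T.
    by rewrite ZC linearN/= !mulNmx mulmxN opprK trmx_mul !mulmxA.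
  rewrite !trE QT QQ -mxtraceD -mulmxDl addrC subrK mul1mx//.
rewrite -[leLHS]addr0 lerD ?mxtrace_psd// CC -mulmxA mxtrace_mulC -mulmxA.
pose tau i := (Z^T *m Z) i i.
have -> : \tr (diag_mx (\row_i sig i) *m (Z^T *m Z)) = \sum_i tau i * sig i.
  by apply: eq_bigr => i _; rewrite mul_diag_mx /tau 2!mxE mulrC.
apply: weighted_sum_ge => //.
  move=> i; rewrite /tau -[X in 0 <= (_ *m X) i i]trmxK mul_mx_tr_diag_ge0/=.
  have := mul_mx_tr_diag_ge0 Q i; by rewrite QT QQ 3!mxE eqxx subr_ge0.
by rewrite -[LHS]/(\tr (Z^T *m Z)) mxtrace_mulC ZZ mxtrace_scalar.
Qed.
End EckartYoung.

Section SecondMoments.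
Context {R : realType}.

(** The squared norm is the sum of the squares of the coordinates of
    L (A y + B x), each of which is a linear functional of (x, y). *)
Lemma expectation_wnorm2_gram k m n d (T : measurableType d) (P : probability T R)
    (x : {RV P >-> n.-tuple R}) (y : {RV P >-> m.-tuple R})
    (G : 'M[R]_(m, n)) (Gobs : 'M[R]_m) (Gpr : 'M[R]_n)
    (L : 'M[R]_(k, n)) (A : 'M[R]_(n, m)) (B : 'M[R]_n) :
  spd Gobs -> spd Gpr -> bayes_linear_model x y G Gobs Gpr ->
  ('E_P[fun o => wnorm2 (L^T *m L) (A *m tcol (y o) + B *m tcol (x o))] =
   (\tr ((L *m (A *m G + B)) *m Gpr *m (L *m (A *m G + B))^T)
    + \tr ((L *m A) *m Gobs *m (L *m A)^T))%:E)%E.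
Proof.
move=> so sp hm; rewrite unlock !mxtrace_wnorm2 -big_split/=.
pose a i := (row i (L *m B))^T; pose b i := (row i (L *m A))^T.
pose f i o := ((((a i)^T *m tcol (x o)) 0 0 + ((b i)^T *m tcol (y o)) 0 0) ^+ 2)%:E.
transitivity (\int[P]_o \sum_(i < k) f i o)%E.
  apply: eq_integral => o _; rewrite wnorm2_gram sumEFin; congr EFin.
  apply: eq_bigr => i _; congr (_ ^+ 2).
  rewrite mulmxDr !mulmxA addrC mxE /a /b !trmxK -!row_mul [in RHS]mxE.
  by congr (_ + _); rewrite [RHS]mxE.
rewrite ge0_integral_sum//; last 2 first.
- move=> i; apply/measurable_EFinP; apply: measurable_funX; apply: measurable_funD.
    exact: (measurableT_comp (measurable_dot_tcol (a i))).
  exact: (measurableT_comp (measurable_dot_tcol (b i))).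
- by move=> i o _; rewrite lee_fin sqr_ge0.
rewrite -sumEFin; apply: eq_bigr => i _.
rewrite (linear_model_second_moment (a i) (b i) so sp hm); congr (EFin (wnorm2 _ _ + _)).
rewrite /a /b -trmx_mul -linearD/= -row_mul -linearD/=; congr (_^T).
by rewrite mulmxDr mulmxA addrC.
Qed.

End SecondMoments.

(** * Characteristic polynomials and sorted spectra *)

Section CharPoly.
Context {F : fieldType}.

(** Sylvester: the block matrix [X, A; B, 1] has determinant det (X - A B) by
    clearing its lower left corner with column operations, and X^m times it is
    X^n det (X - B A) by clearing the same corner with row operations. *)
Lemma char_poly_mulC n m (A : 'M[F]_(n, m)) (B : 'M[F]_(m, n)) :
  'X^m * char_poly (A *m B) = 'X^n * char_poly (B *m A).
Proof.
rewrite /char_poly /char_poly_mx !map_mxM/=.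
set a := map_mx _ A; set b := map_mx _ B.
pose N := block_mx ('X%:M : 'M[{poly F}]_n) a b (1%:M : 'M[{poly F}]_m).
have N1 : \det N = \det ('X%:M - a *m b).
  rewrite -[LHS]mulr1.
  rewrite -[X in _ * X](_ : \det (block_mx (1%:M : 'M[{poly F}]_n) 0 (- b) (1%:M : 'M[{poly F}]_m)) = 1); last first.
    by rewrite det_lblock !det1 mulr1.
  rewrite -det_mulmx mulmx_block !mulmx1 !mulmx0 mul1mx !mulmxN !add0r subrr.
  by rewrite det_ublock det1 mulr1.
have -> : 'X^m = \det (block_mx (1%:M : 'M[{poly F}]_n) 0 (- b) ('X%:M : 'M[{poly F}]_m)).
  by rewrite det_lblock det1 mul1r det_scalar.
rewrite -N1 -det_mulmx mulmx_block !mul1mx !mul0mx !addr0 mulmx1.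
rewrite mul_mx_scalar mul_scalar_mx scalerN addNr det_ublock det_scalar.
by rewrite mulNmx addrC.
Qed.

Lemma char_poly_diagonalizable n (A W : 'M[F]_n) (d : 'I_n -> F) :
  W \in unitmx -> A *m W = W *m diag_mx (\row_i d i) ->
  char_poly A = \prod_i ('X - (d i)%:P).
Proof.
move=> uW AW; pose D := diag_mx (\row_i d i).
have /mulfI : 'X^n != 0 :> {poly F} by rewrite monic_neq0 ?monicXn.
apply; rewrite -(mulmxK uW A) AW -mulmxA char_poly_mulC mulmxKV//.
rewrite char_poly_trig ?diag_mx_is_trig//; congr (_ * _).
by apply: eq_bigr => i _; rewrite !mxE eqxx.
Qed.

Lemma prod_XsubC_perm_eq (s t : seq F) :
  \prod_(x <- s) ('X - x%:P) = \prod_(x <- t) ('X - x%:P) -> perm_eq s t.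
Proof.
elim: s t => [|x s IH] t.
  move=> /(congr1 (fun p : {poly F} => size p)); rewrite !size_prod_XsubC => -[].
  by case: t.
move=> e; have xt : x \in t.
  by rewrite -root_prod_XsubC -e root_prod_XsubC mem_head.
move: e; rewrite (perm_big _ (perm_to_rem xt))/= !big_cons.
move=> /mulfI h; have {h} /IH st := h (negbT (polyXsubC_eq0 x)).
by rewrite perm_sym (permPl (perm_to_rem xt)) perm_cons perm_sym.
Qed.

End CharPoly.

Section SortedSpectra.
Context {R : realFieldType}.

Lemma prod_XsubC_noninc_eq k (a b : nat -> R) :
  (forall i j, (i <= j < k)%N -> a j <= a i) ->
  (forall i j, (i <= j < k)%N -> b j <= b i) ->
  \prod_(i < k) ('X - (a i)%:P) = \prod_(i < k) ('X - (b i)%:P) ->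
  forall i, (i < k)%N -> a i = b i.
Proof.
move=> ha hb e.
have sortedE (c : nat -> R) : (forall i j, (i <= j < k)%N -> c j <= c i) ->
    sorted (fun x y => y <= x) (mkseq c k).
  move=> hc; apply/(sortedP 0) => i; rewrite size_mkseq => ik.
  by rewrite !nth_mkseq ?hc ?leqnSn// ltnW.
have mk (c : nat -> R) : \prod_(i < k) ('X - (c i)%:P) = \prod_(x <- mkseq c k) ('X - x%:P).
  by rewrite /mkseq big_map -(big_mkord xpredT (fun i => 'X - (c i)%:P)) /index_iota subn0.
have ab : mkseq a k = mkseq b k.
  apply: (@sorted_eq _ (fun x y : R => y <= x)).
  - by move=> y x z /= h1 h2; exact: le_trans h2 h1.
  - by move=> x y /= /andP[h1 h2]; apply/eqP; rewrite eq_le h1 h2.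
  - exact: sortedE.
  - exact: sortedE.
  - by apply: prod_XsubC_perm_eq; rewrite -!mk.
by move=> i ik; rewrite -(nth_mkseq 0 a ik) ab nth_mkseq.
Qed.

End SortedSpectra.

(** * Matching the two eigenvalue problems *)

Section Columns.
Context {R : comNzRingType}.

Definition colmx m n (w : 'I_n -> 'cV[R]_m) : 'M[R]_(m, n) :=
  \matrix_(i, j) w j i 0.

Lemma mul_colmx k m n (A : 'M[R]_(k, m)) (w : 'I_n -> 'cV[R]_m) :
  A *m colmx w = colmx (fun j => A *m w j).
Proof. by apply/matrixP => i j; rewrite !mxE; apply: eq_bigr => l _; rewrite mxE. Qed.

Lemma mul_tr_colmx m n k (w : 'I_n -> 'cV[R]_m) (u : 'I_k -> 'cV[R]_m) :
  (colmx w)^T *m colmx u = \matrix_(i, j) ((w i)^T *m u j) 0 0.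
Proof. by apply/matrixP => i j; rewrite !mxE; apply: eq_bigr => l _; rewrite !mxE. Qed.

Lemma colmx_mul_diag m n (w : 'I_n -> 'cV[R]_m) (d : 'I_n -> R) :
  colmx w *m diag_mx (\row_i d i) = colmx (fun j => d j *: w j).
Proof. by apply/matrixP => i j; rewrite mul_mx_diag !mxE mulrC. Qed.

End Columns.

Section Spectra.
Context {R : realType}.
Variables (m n : nat) (G : 'M[R]_(m, n)) (Gobs : 'M[R]_m) (Gpr : 'M[R]_n).
Hypotheses (hobs : spd Gobs) (hpr : spd Gpr).

Variables (delta : 'I_n -> R) (w : 'I_n -> 'cV[R]_n).
Hypothesis hw : prior_eigenpairs G Gobs Gpr delta w.

Local Notation H := (hessian G Gobs).
Local Notation W := (colmx w).
Local Notation D2 := (diag_mx (\row_i (delta i ^+ 2))).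

Lemma eigenbasis_gram : W^T *m invmx Gpr *m W = 1%:M.
Proof.
case: hw => _ _ _ h4; rewrite -mulmxA mul_colmx mul_tr_colmx.
by apply/matrixP => i j; rewrite mxE mulmxA h4 [RHS]mxE.
Qed.

Lemma eigenbasis_cogram : W *m W^T = Gpr.
Proof.
have uP := spd_unitmx hpr.
have := mulmx1C eigenbasis_gram; rewrite mulmxA => h.
by rewrite -[LHS](mulmxKV uP) h mul1mx.
Qed.

Lemma eigenbasis_unitmx : W \in unitmx.
Proof. by have /mulmx1_unit [] := eigenbasis_gram. Qed.

Lemma hessian_eigenbasis : H *m W = invmx Gpr *m W *m D2.
Proof.
case: hw => _ _ h3 _; rewrite -mulmxA colmx_mul_diag !mul_colmx.
by congr colmx; apply/funext => j; have [_ ->] := h3 j; rewrite -scalemxAr.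
Qed.

Lemma hessian_psd z : 0 <= wnorm2 H z.
Proof.
by rewrite /hessian -[X in _ *m X]trmxK wnorm2_conj; apply: spd_psd; apply: spd_invmx.
Qed.

Section DataSide.
Variables (lam : nat -> R) (v : nat -> 'cV[R]_m).
Hypothesis hv : data_eigenvectors G Gobs Gpr lam v.

Lemma data_eigenvalue_ge0 (j : 'I_m) : 0 <= lam j.
Proof.
case: hv => _ h2 h3 _.
have [_ e] := h2 j; have e2 := h3 j.
suff -> : lam j = wnorm2 (G *m Gpr *m G^T) (v j).
  by rewrite wnorm2_conj; exact: spd_psd.
by rewrite /wnorm2 -mulmxA e -scalemxAr mulmxA mxE -/(wnorm2 _ _) e2 mulr1.
Qed.

Let sig (i : nat) : R := if insub i is Some i' then delta i' ^+ 2 else 0.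
Let lam0 (i : nat) : R := if (i < m)%N then lam i else 0.

(** Gpr H and Gobs^-1 G Gpr G^T are A B and B A for A = Gpr G^T and
    B = Gobs^-1 G, so padding both spectra with zeros to length n + m makes the
    two lists of roots equal; both are nonnegative and non-increasing, hence
    equal term by term. *)
Lemma pencil_spectra (i : 'I_n) : delta i ^+ 2 = if (i < m)%N then lam i else 0.
Proof.
case: (hw) => _ h2 _ _; case: (hv) => k1 k2 _ k4.
have uP := spd_unitmx hpr; have uO := spd_unitmx hobs.
pose V := colmx (fun j : 'I_m => v j).
have uV : V \in unitmx.
  rewrite -unitmx_tr -row_free_unit (_ : V^T = \matrix_(i < m) (v i)^T)//.
  by apply/matrixP => a b; rewrite !mxE.
have e1 : char_poly (Gpr *m G^T *m (invmx Gobs *m G)) = \prod_(i < n) ('X - (delta i ^+ 2)%:P).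
  apply: (char_poly_diagonalizable eigenbasis_unitmx).
  rewrite (_ : Gpr *m G^T *m _ = Gpr *m H); last by rewrite /hessian !mulmxA.
  by rewrite -mulmxA hessian_eigenbasis -!mulmxA mulKVmx.
have e2 : char_poly (invmx Gobs *m G *m (Gpr *m G^T)) = \prod_(j < m) ('X - (lam j)%:P).
  apply: (char_poly_diagonalizable uV).
  rewrite -!mulmxA colmx_mul_diag /V !mul_colmx.
  congr colmx; apply/funext => j; have [_] := k2 j; rewrite -!mulmxA => ->.
  by rewrite -scalemxAr mulKmx.
have XE k : 'X^k = \prod_(i < k) ('X - 0%:P) :> {poly R}.
  by rewrite prodr_const card_ord subr0.
have := char_poly_mulC (Gpr *m G^T) (invmx Gobs *m G); rewrite e1 e2 => e.
have sigE (j : 'I_n) : sig j = delta j ^+ 2 by rewrite /sig valK.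
have sig0 j : (n <= j)%N -> sig j = 0 by move=> nj; rewrite /sig insubN// -leqNgt.
have := @prod_XsubC_noninc_eq _ (n + m) sig lam0 _ _ _ i.
rewrite sigE => -> //.
- move=> a b /andP[ab _].
  have [na|an] := leqP n a; first by rewrite !sig0// (leq_trans na).
  have [nb|bn] := leqP n b; last by rewrite (sigE (Ordinal an)) (sigE (Ordinal bn)) h2.
  by rewrite sig0// (sigE (Ordinal an)) sqr_ge0.
- move=> a b /andP[ab _]; rewrite /lam0.
  have [bm|mb] := ltnP b m.
    by rewrite (leq_ltn_trans ab bm) k1// ab.
  by case: ifP => // am; exact: (data_eigenvalue_ge0 (Ordinal am)).
- transitivity ('X^m * \prod_(i < n) ('X - (delta i ^+ 2)%:P)).
    rewrite big_split_ord/= mulrC XE; congr (_ * _).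
      by apply: eq_bigr => j _; rewrite sig0// leq_addr.
    by apply: eq_bigr => j _; rewrite sigE.
  rewrite e addnC big_split_ord/= mulrC XE; congr (_ * _).
    by apply: eq_bigr => j _; rewrite /lam0 ltn_ord.
  by apply: eq_bigr => j _; rewrite /lam0 ltnNge leq_addr.
- by rewrite ltn_addr.
Qed.

Hypothesis hwv : matched G delta w lam v.

(** Put j = i. Expanding over the basis w, lam_j v_j is the sum over k of
    (w_k^T G^T v_j) Gobs^-1 G w_k. The coefficients with k <> i vanish: for equal
    eigenvalues this is the matching, for distinct ones the orthogonality of
    eigenvectors. The normalisation of v_j makes the remaining coefficient a
    square root of lam_j, and the matching makes it nonnegative. *)
Lemma matched_singular_vectors (i : 'I_n) :
  invmx Gobs *m G *m w i = delta i *: v i.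
Proof.
case: (hw) => d0 _ h3 _; case: (hv) => _ k2 k3 _.
have uP := spd_unitmx hpr; have uO := spd_unitmx hobs.
have sO : (invmx Gobs)^T = invmx Gobs by have [] := spd_invmx hobs.
have := pencil_spectra i.
have [di0 _|di0] := eqVneq (delta i) 0.
  (* Here w_i is in the kernel of H, hence in that of G. *)
  rewrite di0 scale0r.
  have [_ e] := h3 i.
  have : wnorm2 (invmx Gobs) (G *m w i) = 0.
    rewrite /wnorm2 trmx_mul -!mulmxA [G^T *m _]mulmxA mulmxA -mulmxA.
    rewrite [X in _ *m X](_ : _ = H *m w i); last by rewrite /hessian -!mulmxA.
    by rewrite e di0 expr0n scale0r mulmx0 mxE.
  have [_ p] := spd_invmx hobs.
  have [g0 _|/p] := eqVneq (G *m w i) 0; first by rewrite -mulmxA g0 mulmx0.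
  by move=> h h0; rewrite h0 ltxx in h.
have dip : 0 < delta i by rewrite lt_neqAle eq_sym di0 d0.
have [im|_] := ltnP i m; last first.
  by move/eqP; rewrite sqrf_eq0 (negbTE di0).
move=> dl; pose j := Ordinal im; rewrite -[nat_of_ord i]/(nat_of_ord j) in dl *.
pose al (k : 'I_n) := ((w k)^T *m G^T *m v j) 0 0.
have [_ ej] := k2 j.
have off k : k != i -> al k = 0.
  move=> ki; have [kl|kl] := eqVneq (delta k ^+ 2) (lam j).
    by have [h _] := hwv kl; apply: h.
  have : lam j * al k = delta k ^+ 2 * al k.
    have : ((w k)^T *m G^T *m invmx Gobs *m (G *m Gpr *m G^T *m v j)) 0 0 = lam j * al k.
      by rewrite ej -scalemxAr mxE -!mulmxA mulKmx// !mulmxA.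
    move=> <-; have [_ ek] := h3 k.
    have -> : (w k)^T *m G^T *m invmx Gobs *m (G *m Gpr *m G^T *m v j) =
       (H *m w k)^T *m (Gpr *m G^T *m v j).
      by rewrite /hessian !trmx_mul trmxK sO !mulmxA.
    rewrite ek linearZ/= trmx_mul trmx_inv.
    have [-> _] := hpr.
    by rewrite -scalemxAl mxE -!mulmxA mulKmx// !mulmxA.
  move/eqP; rewrite -subr_eq0 -mulrBl mulf_eq0 subr_eq0 eq_sym (negbTE kl)/=.
  by move/eqP.
have key : lam j *: v j = al i *: (invmx Gobs *m G *m w i).
  have -> : lam j *: v j = invmx Gobs *m (G *m (W *m (W^T *m (G^T *m v j)))).
    rewrite (mulmxA W) eigenbasis_cogram (mulmxA Gpr) (mulmxA G) (mulmxA G) ej.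
    by rewrite -scalemxAr mulKmx.
  have -> : W *m (W^T *m (G^T *m v j)) = al i *: w i.
    have alE k : (W^T *m (G^T *m v j)) k 0 = al k.
      by rewrite /al -mulmxA !mxE; apply: eq_bigr => l _; rewrite !mxE.
    apply/colP => a; rewrite mxE (bigD1 i)//= big1 ?addr0.
      by rewrite alE !mxE mulrC.
    by move=> k ki; rewrite alE off// mulr0.
  by rewrite -!scalemxAr mulmxA.
have al0 : 0 <= al i.
  by have [_ h] := hwv dl; apply: h.
have al2 : lam j = al i ^+ 2.
  have := congr1 (fun z => ((v j)^T *m Gobs *m z) 0 0) key.
  rewrite -!scalemxAr mxE => e; rewrite [in RHS]mxE in e.
  move: e; have := k3 j; rewrite /wnorm2 => ->; rewrite mulr1 => ->.
  rewrite expr2; congr (_ * _).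
  rewrite -!mulmxA mulKVmx// /al.
  have -> : (v j)^T *m (G *m w i) = ((w i)^T *m G^T *m v j)^T.
    by rewrite !trmx_mul !trmxK.
  by rewrite mxE.
have ald : al i = delta i.
  by apply/eqP; rewrite -(eqrXn2 (n:=2))// ?ltW// -al2 dl.
rewrite ald -dl expr2 -scalerA in key.
by have := scalerI di0 key.
Qed.

End DataSide.
End Spectra.

(** * Completing the square *)

Section BayesRisk.
Context {R : realType}.
Variables (m n : nat) (G : 'M[R]_(m, n)) (Gobs : 'M[R]_m) (Gpr : 'M[R]_n).
Hypotheses (hobs : spd Gobs) (hpr : spd Gpr).

Local Notation H := (hessian G Gobs).
Local Notation Gpos := (post_cov G Gobs Gpr).

Definition data_cov : 'M[R]_m := G *m Gpr *m G^T + Gobs.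
Definition gain : 'M[R]_(n, m) := Gpos *m G^T *m invmx Gobs.

Lemma data_cov_psd z : 0 <= wnorm2 data_cov z.
Proof. by rewrite wnorm2D wnorm2_conj addr_ge0 ?spd_psd. Qed.

Lemma precision_unitmx : H + invmx Gpr \in unitmx.
Proof.
apply: spd_unitmx; have [iT i0] := spd_invmx hpr; have [oT _] := spd_invmx hobs.
split; first by rewrite linearD/= iT /hessian !trmx_mul trmxK oT mulmxA.
by move=> z z0; rewrite wnorm2D ltr_wpDl ?i0// (hessian_psd G hobs).
Qed.

Lemma post_cov_mulmx : Gpos *m (H + invmx Gpr) = 1%:M.
Proof. exact: mulVmx precision_unitmx. Qed.

(** The normal equations of the regression of x on y: Gpr G^T is the
    cross-covariance of x and y. *)
Lemma gain_mul_data_cov : gain *m data_cov = Gpr *m G^T.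
Proof.
rewrite -[RHS]mul1mx -post_cov_mulmx -!mulmxA; congr (_ *m _).
rewrite /data_cov !mulmxDr (mulVmx (spd_unitmx hobs)) mulmx1.
by rewrite mulmxDl mulKmx ?spd_unitmx// /hessian !mulmxA.
Qed.

Lemma post_covE : Gpos = Gpr - gain *m G *m Gpr.
Proof.
apply/eqP; rewrite eq_sym subr_eq addrC; apply/eqP.
rewrite -[LHS]mul1mx -post_cov_mulmx -mulmxA mulmxDl mulVmx ?spd_unitmx//.
by rewrite mulmxDr mulmx1 /gain /hessian !mulmxA.
Qed.

(** The left-hand side is the covariance of A y - x. By the normal equations the
    posterior error is uncorrelated with y, so the two parts of
    A y - x = (A - K) y + (K y - x) add up without cross terms. *)
Lemma error_cov_decomposition (A : 'M[R]_(n, m)) :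
  (A *m G - 1%:M) *m Gpr *m (A *m G - 1%:M)^T + A *m Gobs *m A^T =
  (A - gain) *m data_cov *m (A - gain)^T + Gpos.
Proof.
have [pT _] := hpr; have [oT _] := hobs.
have cT : data_cov^T = data_cov.
  by rewrite /data_cov linearD/= oT !trmx_mul trmxK pT mulmxA.
have e1 := gain_mul_data_cov.
have e2 : data_cov *m gain^T = G *m Gpr.
  by rewrite -[LHS]trmxK trmx_mul trmxK cT e1 trmx_mul trmxK pT.
have trB p q (X Y : 'M[R]_(p, q)) : (X - Y)^T = X^T - Y^T by rewrite linearB.
rewrite post_covE !trB trmx1 trmx_mul !mulmxBr !mulmxBl !mulmx1 !mul1mx.
rewrite -[gain *m data_cov *m gain^T]mulmxA e2 e1 -[A *m data_cov *m gain^T]mulmxA e2.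
rewrite /data_cov mulmxDr mulmxDl !mulmxA.
apply/matrixP => i j.
move: (A *m G *m Gpr *m G^T *m A^T) (A *m Gobs *m A^T) (A *m G *m Gpr)
  (gain *m G *m Gpr) (Gpr *m G^T *m A^T) => X1 X2 X3 X4 X5.
rewrite !mxE; ring.
Qed.

(** * Diagonalisation and optimality *)

Section Whitening.
Variables (delta : 'I_n -> R) (w : 'I_n -> 'cV[R]_n).
Hypothesis hw : prior_eigenpairs G Gobs Gpr delta w.

Local Notation W := (colmx w).
Local Notation dg f := (diag_mx (\row_i (f i : R))).

(** The inverse of W. *)
Let Wi := W^T *m invmx Gpr.
(** A square root of the posterior precision: see [whitening_gram]. It is chosen
    so that the whitened gain has orthogonal rows. *)
Definition whitening : 'M[R]_n := dg (fun i => Num.sqrt (1 + delta i ^+ 2)) *m Wi.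
Local Notation L := whitening.

Let WiW : Wi *m W = 1%:M. Proof. exact: eigenbasis_gram hw. Qed.
Let WWi : W *m Wi = 1%:M. Proof. exact: mulmx1C WiW. Qed.
Let WiT : Wi^T = invmx Gpr *m W.
Proof. by have [pT _] := spd_invmx hpr; rewrite trmx_mul trmxK pT. Qed.

Let prior_precisionE : invmx Gpr = Wi^T *m Wi.
Proof. by rewrite WiT -mulmxA WWi mulmx1. Qed.

Let hessianE : H = Wi^T *m dg (fun i => delta i ^+ 2) *m Wi.
Proof. by rewrite WiT -(hessian_eigenbasis hw) -mulmxA WWi mulmx1. Qed.

Lemma whitening_gram : L^T *m L = H + invmx Gpr.
Proof.
rewrite hessianE prior_precisionE /L trmx_mul tr_diag_mx.
set E := diag_mx _; set D := diag_mx _.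
have EE : E *m E = D + 1%:M.
  rewrite mulmx_diag; apply/matrixP => i j.
  by rewrite !mxE -expr2 sqr_sqrtr ?addr_ge0 ?sqr_ge0// addrC mulrnDl.
by rewrite -!mulmxA (mulmxA E) EE mulmxDl mul1mx mulmxDr.
Qed.

Let post_cov_eig : Gpos = W *m dg (fun i => (1 + delta i ^+ 2)^-1) *m W^T.
Proof.
have e : W *m dg (fun i => (1 + delta i ^+ 2)^-1) *m W^T *m (H + invmx Gpr) = 1%:M.
  rewrite -whitening_gram /L trmx_mul tr_diag_mx.
  set D := diag_mx _; set E := diag_mx _.
  have DEE : D *m (E *m E) = 1%:M.
    rewrite !mulmx_diag; apply/matrixP => i j; rewrite !mxE -expr2.
    by rewrite sqr_sqrtr ?addr_ge0 ?sqr_ge0// mulVf// gt_eqF// ltr_wpDr ?sqr_ge0.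
  rewrite -!mulmxA (mulmxA W^T) -trmx_mul WiW trmx1 mul1mx (mulmxA E) (mulmxA D).
  by rewrite DEE mul1mx WWi.
by rewrite -[LHS]mul1mx -e mulmxK ?precision_unitmx.
Qed.

Let pid_mxE r : pid_mx r = dg (fun i : 'I_n => (i < r)%N%:R).
Proof.
by apply/matrixP => i j; rewrite !mxE -val_eqE; case: (_ == _).
Qed.

Lemma whitened_gain_cov :
  L *m gain *m data_cov *m (L *m gain)^T = dg (fun i => delta i ^+ 2).
Proof.
have posT : Gpos^T = Gpos.
  by rewrite post_cov_eig !trmx_mul trmxK tr_diag_mx mulmxA.
have [iT _] := spd_invmx hobs.
have -> : L *m gain *m data_cov *m (L *m gain)^T = L *m Gpr *m H *m Gpos *m L^T.
  rewrite -(mulmxA L) gain_mul_data_cov trmx_mul /gain !trmx_mul trmxK iT posT.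
  by rewrite /hessian !mulmxA.
have WWT : W^T *m Wi^T = 1%:M by rewrite -trmx_mul WiW trmx1.
have -> : L^T = Wi^T *m dg (fun i => Num.sqrt (1 + delta i ^+ 2)).
  by rewrite /L trmx_mul tr_diag_mx.
rewrite hessianE post_cov_eig -(eigenbasis_cogram hpr hw) /L.
set E := diag_mx _; set D := diag_mx _; set D' := diag_mx _.
have -> : E *m Wi *m (W *m W^T) *m (Wi^T *m D *m Wi) *m (W *m D' *m W^T) *m (Wi^T *m E)
   = E *m D *m D' *m E.
  (* Wi is generalized, lest rewriting with associativity unfold it. *)
  move: (Wi) WiW WWT => V VW WV.
  rewrite -!mulmxA (mulmxA W^T V^T) WV mul1mx (mulmxA V W) VW mul1mx.
  by rewrite (mulmxA W^T V^T) WV mul1mx (mulmxA V W) VW mul1mx.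
rewrite !mulmx_diag; apply/matrixP => i j; rewrite !mxE; congr (_ *+ _).
have p : 0 < 1 + delta i ^+ 2 by rewrite ltr_wpDr ?sqr_ge0.
rewrite mulrC !mulrA -expr2 sqr_sqrtr ?(ltW p)//.
by field; rewrite gt_eqF.
Qed.

Section Optimum.
Variables (lam : nat -> R) (v : nat -> 'cV[R]_m).
Hypotheses (hv : data_eigenvectors G Gobs Gpr lam v)
  (hwv : matched G delta w lam v).
Variable r : nat.

(** In the basis w, the gain is the sum of the
    (1 + delta_i^2)^-1 w_i (Gobs^-1 G w_i)^T, that is, of the
    delta_i / (1 + delta_i^2) w_i v_i^T over all i. *)
Lemma AoptE : Aopt r delta w v = W *m pid_mx r *m Wi *m gain.
Proof.
have [oT _] := spd_invmx hobs.
have WG : W^T *m G^T *m invmx Gobs = (colmx (fun i => delta i *: v i))^T.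
  rewrite -[LHS]trmxK; congr (_^T); rewrite !trmx_mul !trmxK oT mulmxA mul_colmx.
  congr colmx; apply/funext => i.
  exact: (matched_singular_vectors hobs hpr hw hv hwv).
rewrite /gain post_cov_eig.
set D := diag_mx _.
have -> : W *m pid_mx r *m Wi *m (W *m D *m W^T *m G^T *m invmx Gobs) =
    W *m (pid_mx r *m D) *m (W^T *m G^T *m invmx Gobs).
  by move: (Wi) WiW => V VW; rewrite -!mulmxA (mulmxA V) VW mul1mx.
rewrite WG pid_mxE mulmx_diag mul_mx_diag.
apply/matrixP => a b; rewrite /Aopt summxE mxE big_mkcond.
apply: eq_bigr => i _; rewrite !mxE big_ord1 !mxE (_ : ord0 = 0 :> 'I_1)//.
case: ltnP => _ /=; last by rewrite mul0r mulr0 mul0r.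
by rewrite mul1r; ring.
Qed.

Lemma rank_Aopt : (r <= n)%N -> (\rank (Aopt r delta w v) <= r)%N.
Proof.
move=> rn; rewrite AoptE -!mulmxA.
rewrite (leq_trans (mxrankM_maxr _ _))// (leq_trans (mxrankM_maxl _ _))//.
by rewrite rank_pid_mx.
Qed.

Lemma whitened_Aopt : L *m Aopt r delta w v = pid_mx r *m (L *m gain).
Proof.
rewrite AoptE /L; move: (Wi) WiW gain => V VW K.
rewrite -!mulmxA (mulmxA V W) VW mul1mx !mulmxA; congr (_ *m _ *m _).
rewrite pid_mxE !mulmx_diag; congr diag_mx.
by apply/rowP => i; rewrite !mxE mulrC.
Qed.

(** Only the last n - r rows of the whitened gain are missed, and they are
    orthogonal with squared norms delta_i^2. *)
Lemma excess_Aopt :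
  \tr ((L *m (Aopt r delta w v - gain)) *m data_cov *m
       (L *m (Aopt r delta w v - gain))^T) =
  \sum_(i < n | (r <= i)%N) delta i ^+ 2.
Proof.
have -> : L *m (Aopt r delta w v - gain) = (pid_mx r - 1%:M) *m (L *m gain).
  by rewrite mulmxBr whitened_Aopt mulmxBl mul1mx.
set Q := pid_mx r - 1%:M.
have QE : Q = dg (fun i : 'I_n => (i < r)%N%:R - 1).
  apply/matrixP => i j; rewrite !mxE -val_eqE.
  by case: (_ == _) => //=; rewrite subrr.
have := whitened_gain_cov; move: (L *m gain) => C CC.
rewrite trmx_mul (_ : _ *m (C^T *m Q^T) = Q *m (C *m data_cov *m C^T) *m Q^T).
  rewrite CC QE tr_diag_mx !mulmx_diag mxtrace_diag [RHS]big_mkcond.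
  apply: eq_bigr => i _; rewrite !mxE; case: ltnP => _ /=.
    by rewrite subrr !mul0r.
  by rewrite sub0r; ring.
by rewrite !mulmxA.
Qed.
End Optimum.

Lemma excess_ge (r : nat) (A : 'M[R]_(n, m)) : (\rank A <= r)%N ->
  \sum_(i < n | (r <= i)%N) delta i ^+ 2 <=
  \tr ((L *m (A - gain)) *m data_cov *m (L *m (A - gain))^T).
Proof.
move=> rA; rewrite mulmxBr.
apply: eckart_young whitened_gain_cov _ _.
- exact: data_cov_psd.
- by case: hw.
- exact: leq_trans (mxrankM_maxr _ _) rA.
Qed.

End Whitening.
End BayesRisk.

Theorem theorem4p1 (R : realType) (m n r : nat)
    (d : measure_display) (T : measurableType d) (P : probability T R)
    (x : {RV P >-> n.-tuple R}) (y : {RV P >-> m.-tuple R})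
    (G : 'M[R]_(m, n)) (Gobs : 'M[R]_m) (Gpr : 'M[R]_n)
    (delta : 'I_n -> R) (w : 'I_n -> 'cV[R]_n)
    (lam : nat -> R) (v : nat -> 'cV[R]_m)
    (hobs : spd Gobs) (hpr : spd Gpr)
    (hmodel : bayes_linear_model x y G Gobs Gpr)
    (hw : prior_eigenpairs G Gobs Gpr delta w)
    (hv : data_eigenvectors G Gobs Gpr lam v)
    (hwv : matched G delta w lam v)
    (hr : (1 <= r <= n)%N) :
  let S := invmx (post_cov G Gobs Gpr) in
  let As : 'M[R]_(n, m) := Aopt r delta w v in
  [/\ (\rank As <= r)%N
      /\ (forall A : 'M[R]_(n, m), (\rank A <= r)%N ->
            (bayes_risk x y S As <= bayes_risk x y S A)%E),
      bayes_risk x y S As =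
        ('E_P[fun o => wnorm2 S (As *m tcol (y o)
                                  - post_mean G Gobs Gpr (tcol (y o)))]
         + 'E_P[fun o => wnorm2 S (post_mean G Gobs Gpr (tcol (y o))
                                    - tcol (x o))])%E
    & bayes_risk x y S As =
        ((\sum_(i < n | (r <= i)%N) delta i ^+ 2) + n%:R)%:E].
Proof.
move=> S As.
set K := gain G Gobs Gpr; set L := whitening Gpr delta w.
set N := data_cov G Gobs Gpr.
have SE : S = L^T *m L by rewrite /S /post_cov invmxK (whitening_gram hpr hw).
pose excess (A : 'M[R]_(n, m)) := \tr ((L *m (A - K)) *m N *m (L *m (A - K))^T).
have conjL p (X : 'M[R]_(n, p)) (Y : 'M[R]_p) :
    (L *m X) *m Y *m (L *m X)^T = L *m (X *m Y *m X^T) *m L^T.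
  by rewrite trmx_mul !mulmxA.
have trL : \tr (L *m post_cov G Gobs Gpr *m L^T) = n%:R.
  rewrite mxtrace_mulC mulmxA (whitening_gram hpr hw).
  by rewrite (mulmx1C (post_cov_mulmx G hobs hpr)) mxtrace1.
have riskE A : bayes_risk x y S A = (excess A + n%:R)%:E.
  rewrite /bayes_risk SE (_ : (fun o => _) = fun o => wnorm2 (L^T *m L)
      (A *m tcol (y o) + (- 1%:M) *m tcol (x o))); last first.
    by apply/funext => o; rewrite mulNmx mul1mx.
  rewrite (expectation_wnorm2_gram L A _ hobs hpr hmodel); congr EFin.
  rewrite -trL /excess !conjL -!mxtraceD -!mulmxDl -!mulmxDr.
  by rewrite (error_cov_decomposition G hobs hpr A).
have posteriorE : ('E_P[fun o => wnorm2 S (post_mean G Gobs Gpr (tcol (y o))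
    - tcol (x o))] = n%:R%:E)%E.
  by rewrite -[LHS]/(bayes_risk x y S K) riskE /excess subrr mulmx0 !mul0mx mxtrace0 add0r.
have excessE A : ('E_P[fun o => wnorm2 S (A *m tcol (y o)
    - post_mean G Gobs Gpr (tcol (y o)))] = (excess A)%:E)%E.
  rewrite SE (_ : (fun o => _) = fun o => wnorm2 (L^T *m L)
      ((A - K) *m tcol (y o) + 0 *m tcol (x o))); last first.
    by apply/funext => o; rewrite mul0mx addr0 mulmxBl.
  rewrite (expectation_wnorm2_gram L _ _ hobs hpr hmodel) addr0; congr EFin.
  rewrite /excess !conjL -mxtraceD -mulmxDl -mulmxDr; congr (\tr (L *m _ *m _)).
  by rewrite trmx_mul /N /data_cov [in RHS]mulmxDr [in RHS]mulmxDl !mulmxA.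
have AsE : excess As = \sum_(i < n | (r <= i)%N) delta i ^+ 2.
  exact: (excess_Aopt hobs hpr hw hv hwv).
have /andP[_ rn] := hr.
split; last by rewrite riskE AsE.
- split=> [|A rA]; first exact: (rank_Aopt hobs hpr hw hv hwv).
  rewrite !riskE lee_fin lerD2r AsE.
  exact: (excess_ge hobs hpr hw).
- by rewrite riskE excessE posteriorE.
Qed.
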